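(* Let $a_n$ denote the number of stabilized-interval-free (SIF) permutations on $[n]=\{1,2,\dots,n\}$. Then, as $n\to\infty$, $$\frac{a_n}{n!}=e^{-1}\left(1-\frac{1}{n}-\frac{5}{2n^2}+O\left(\frac{1}{n^3}\right)\right).$$
   Context: A permutation $\sigma$ of $[n]=\{1,2,\dots,n\}$ is called stabilized-interval-free (SIF) if it does not stabilize any proper subinterval of $[n]$, i.e. there is no nonempty set $I\subsetneq [n]$ of consecutive integers with $\sigma(I)=I$. For example, for $n=2$ the only SIF permutation is $(1\,2)$; for $n=3$ they are the two 3-cycles; for $n=4$ they are $(1\,3)(2\,4)$ and the six 4-cycles. *)

(* Defs.v *)
From mathcomp Require Import all_boot.
From mathcomp Require Import perm.

Set Implicit Arguments.
Unset Strict Implicit.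
Unset Printing Implicit Defensive.

(* [n] = {1, ..., n} is represented by 'I_n = {0, ..., n - 1}; the shift by one
   preserves sets of consecutive integers. *)

(* The empty set is included (i > j, when n >= 2): nonemptiness is required
   separately in SIF. *)
Definition consecutive (n : nat) (I : {set 'I_n}) : bool :=
  [exists i : 'I_n, exists j : 'I_n, I == [set k : 'I_n | i <= k <= j]].

Definition SIF (n : nat) (s : 'S_n) : bool :=
  [forall I : {set 'I_n},
     [&& consecutive I, I != set0 & I \proper [set: 'I_n]] ==> (s @: I != I)].

Definition num_SIF (n : nat) : nat := #|[set s : 'S_n | SIF s]|.

(* Main.v *)
Require Import Defs.
From mathcomp Require Import all_boot all_order all_algebra.
From mathcomp Require Import all_classical all_reals all_analysis.
From mathcomp Require Import fingroup perm action zify ring lra.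
From mathcomp Require Import fintype finset.

Set Implicit Arguments.
Unset Strict Implicit.
Unset Printing Implicit Defensive.

Import Order.TTheory GRing.Theory Num.Theory.
Import numFieldNormedType.Exports.

(** A permutation of [n >= 2] points that is stabilized-interval-free has no
    fixed point, so it is enough to count the derangements that stabilise some
    proper interval, with an error [O((n - 3)!)], which is [O(n! / n^3)].

    Write [a_n] for the number to be estimated and [d_k] for the number of
    derangements of [k] points. A derangement
    stabilising pairwise disjoint sets splits into derangements of these sets
    and of the rest ([stabs_disjoint]), so a set of [k] points is stabilised by
    [d_k d_(n - k)] derangements. Hence intervals of size [k] matter only if [k]
    is 2 or 3, or if [k = n - 2], where the complement is a pair. The
    complements of the intervals of size [n - 2] are cyclically adjacent pairs:
    altogether there are [n] cyclic pairs, each stabilised by [d_(n - 2)]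
    derangements, and [n - 2] intervals of size 3, each stabilised by
    [2 d_(n - 3)]. Two distinct sets of at most three points stabilised by the
    same derangement are disjoint ([stab_small_disjoint]); two disjoint cyclic
    pairs can be chosen in [n (n - 3) / 2] ways, and all other coincidences are
    of size [O((n - 3)!)]. Bonferroni's inequalities ([sieve_upper],
    [sieve_lower]) therefore give ([num_SIF_sieve])

      [a_n = d_n - n d_(n - 2) - 2 (n - 2) d_(n - 3)
             + n (n - 3) / 2 d_(n - 4) + O((n - 3)!)].

    Finally [d_k] differs from [k! / e] by at most 1 ([subfact_approx]), so that
    [e a_n / n!] is, up to [O(n^-3)],

      [1 - 1 / (n - 1) - 2 / (n (n - 1)) + 1 / (2 (n - 1) (n - 2))],

    which is [1 - 1 / n - 5 / (2 n^2) + O(n^-3)]. *)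

(** * Supports and stabilised sets *)

Section Derangements.
Variable T : finType.
Implicit Types (s u v : {perm T}) (A B S X : {set T}) (L : seq {set T}).

(** The perms with [supp s == S] are the derangements of [S], extended by the
    identity outside [S]; keeping one ambient type for all [S] turns restriction
    to a stable subset into a factorisation in the group of perms of [T]. *)
Definition supp s : {set T} := [set x | s x != x].

Definition stab s A : bool := s @: A == A.

Definition der_on S : nat := #|[set s : {perm T} | supp s == S]|.

Lemma suppE s x : (x \in supp s) = (s x != x).
Proof. by rewrite inE. Qed.

Lemma mem_supp s x : (s x \in supp s) = (x \in supp s).
Proof. by rewrite !suppE (inj_eq perm_inj). Qed.

Lemma perm_on_supp s S : perm_on S s = (supp s \subset S).
Proof. by apply: eq_subset => x; rewrite !inE. Qed.

Lemma mem_stab s A x : stab s A -> (s x \in A) = (x \in A).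
Proof. by move=> /eqP eA; rewrite -{1}eA mem_imset //; apply: perm_inj. Qed.

Lemma stabP s A : reflect (forall x, (s x \in A) = (x \in A)) (stab s A).
Proof.
apply: (iffP idP) => [sA x|sA]; first exact: mem_stab.
rewrite /stab eqEcard card_imset ?leqnn ?andbT; last exact: perm_inj.
by apply/subsetP=> _ /imsetP[x xA ->]; rewrite sA.
Qed.

Lemma stabI s A B : stab s A -> stab s B -> stab s (A :&: B).
Proof. by move=> sA sB; apply/stabP=> x; rewrite !inE !(mem_stab x). Qed.

Lemma stabD s A B : stab s A -> stab s B -> stab s (A :\: B).
Proof. by move=> sA sB; apply/stabP=> x; rewrite !inE !(mem_stab x). Qed.

Lemma stabC s A : stab s A -> stab s (~: A).
Proof. by move=> sA; apply/stabP=> x; rewrite !inE !(mem_stab x). Qed.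

Lemma stab1 s x : stab s [set x] = (s x == x).
Proof. by rewrite /stab imset_set1 (inj_eq set1_inj). Qed.

Lemma card_stab_neq1 s A : supp s = setT -> stab s A -> #|A| != 1.
Proof.
move=> sT sA; apply/negP=> /cards1P[x Ax]; rewrite Ax stab1 in sA.
by have := suppE s x; rewrite sT inE sA.
Qed.

(** The two differences and the intersection of stabilised sets are stabilised,
    and a derangement stabilises no singleton; with at most three points in each
    set, two differences avoiding size 1 leave no room for a proper overlap. *)
Lemma stab_small_disjoint s A B : supp s = setT -> stab s A -> stab s B ->
  #|A| <= 3 -> #|B| <= 3 -> A != B -> [disjoint A & B].
Proof.
move=> sT sA sB A3 B3; apply: contraR; rewrite -setI_eq0 -cards_eq0 => I0.
have := card_stab_neq1 sT (stabI sA sB).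
have := card_stab_neq1 sT (stabD sA sB).
have := card_stab_neq1 sT (stabD sB sA).
have := cardsID B A; have := cardsID A B; rewrite setIC => eB eA nBA nAB nI.
have AB0 : #|A :\: B| = 0 by lia.
have BA0 : #|B :\: A| = 0 by lia.
by rewrite eqEsubset -!setD_eq0 -!cards_eq0 AB0 BA0.
Qed.

Lemma der_on_le S : der_on S <= (#|S|)`!.
Proof.
rewrite -card_perm; apply: subset_leq_card; apply/subsetP=> s.
by rewrite inE => /eqP sS; rewrite -topredE /= perm_on_supp sS.
Qed.

Lemma supp_mul u v A B : [disjoint A & B] -> supp u = A -> supp v = B ->
  supp (u * v)%g = A :|: B.
Proof.
move=> dAB uA vB; apply/setP=> x; rewrite in_setU -uA -vB !suppE permM.
have [ux|ux] /= := eqVneq (u x) x; first by rewrite ux.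
have uxA : u x \in A by rewrite -uA mem_supp suppE.
suff -> : v (u x) = u x by [].
by apply/eqP; rewrite -[_ == _]negbK -suppE vB (disjointFr dAB uxA).
Qed.

Lemma perm_on_fix u A x : supp u = A -> x \notin A -> u x = x.
Proof. by move=> <-; rewrite suppE negbK => /eqP. Qed.

(** A derangement of [A :|: B] stabilising [A] is, in a unique way, a product of
    a derangement of [A] and one of [B]. The predicate [P], insensitive to the
    first factor, lets the splitting be iterated over several stable sets. *)
Lemma card_der_split A B (P : pred {perm T}) : [disjoint A & B] ->
    (forall u v, supp u = A -> supp v = B -> P (u * v)%g = P v) ->
  #|[set s | [&& supp s == A :|: B, stab s A & P s]]| =
  der_on A * #|[set v | (supp v == B) && P v]|.
Proof.
move=> dAB hP; rewrite /der_on -cardsX.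
have inj : {in setX [set u | supp u == A] [set v | (supp v == B) && P v] &,
            injective (fun p : {perm T} * {perm T} => (p.1 * p.2)%g)}.
  move=> [u v] [u' v']; rewrite !inE /= => /andP[/eqP uA /andP[/eqP vB _]].
  move=> /andP[/eqP uA' /andP[/eqP vB' _]] /permP e.
  have euu : u = u'.
    apply/permP=> x; have := e x; rewrite !permM.
    have [xA|xA] := boolP (x \in A); last first.
      by rewrite (perm_on_fix uA) ?(perm_on_fix uA').
    have uxA : u x \in A by rewrite -uA mem_supp uA.
    have uxA' : u' x \in A by rewrite -uA' mem_supp uA'.
    by rewrite (perm_on_fix vB) ?(perm_on_fix vB') ?(disjointFr dAB).
  congr (_, _) => //; subst u'; apply/permP=> x.
  by have := e (u^-1 x)%g; rewrite !permM permKV.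
rewrite -(card_in_imset inj); apply: eq_card => s; rewrite inE.
apply/and3P/imsetP => [[/eqP sAB sA Ps]|[[u v]]]; last first.
  rewrite !inE /= => /andP[/eqP uA /andP[/eqP vB Pv]] ->.
  split; [by apply/eqP; apply: supp_mul| |by rewrite (hP u)].
  apply/stabP => x; rewrite permM; have [xA|xA] := boolP (x \in A).
    have uxA : u x \in A by rewrite -uA mem_supp uA.
    by rewrite (perm_on_fix vB) // (disjointFr dAB uxA).
  rewrite (perm_on_fix uA) //; have [xB|xB] := boolP (x \in B).
    have vxB : v x \in B by rewrite -vB mem_supp vB.
    by rewrite (disjointFl dAB vxB).
  by rewrite (perm_on_fix vB) // (negPf xA).
pose u := restr_perm A s.
have sN : (s \in 'N(A | 'P))%g.
  by rewrite !inE; apply/subsetP=> x xA; rewrite !inE /= apermE mem_stab.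
have uE x : u x = if x \in A then s x else x.
  case: ifPn => xA; first exact: restr_permE.
  by apply: out_perm xA; apply: restr_perm_on.
have uA : supp u = A.
  apply/setP=> x; rewrite suppE uE; case: ifPn => xA; last by rewrite eqxx.
  by rewrite -suppE sAB inE xA.
have vE x : (u^-1 * s)%g x = if x \in A then x else s x.
  rewrite permM; case: ifPn => xA.
    have uVA : (u^-1)%g x \in A.
      by rewrite (perm_closed _ (perm_onV (restr_perm_on A s))).
    by rewrite -[RHS](permKV u) uE uVA.
  suff -> : (u^-1)%g x = x by [].
  by apply: (@perm_inj _ u); rewrite permKV uE (negPf xA).
have vB : supp (u^-1 * s)%g = B.
  apply/setP=> x; rewrite suppE vE; case: ifPn => xA.
    by rewrite eqxx (disjointFr dAB xA).
  by rewrite -suppE sAB inE (negPf xA).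
exists (u, u^-1 * s)%g; last by rewrite /= mulKVg.
by rewrite !inE /= uA vB !eqxx /= -(hP u) // mulKVg.
Qed.

(** The quantity that the sieve sums: derangements of [B] stabilising every set
    of a list, so that one notion covers single sets, pairs and triples. *)
Definition stabs B L : nat := #|[set s | (supp s == B) && all (stab s) L]|.

Lemma stabs_nil B : stabs B [::] = der_on B.
Proof. by apply: eq_card => s; rewrite !inE andbT. Qed.

Lemma stabs_cons B A L : A \subset B -> all (fun X => X \subset B :\: A) L ->
  stabs B (A :: L) = der_on A * stabs (B :\: A) L.
Proof.
move=> sAB /allP sL; rewrite /stabs -card_der_split.
- by rewrite setDE setUIr setUCr setIT (setUidPr sAB).
- by rewrite -setI_eq0 setDE setICA setICr setI0.
move=> u v uA vB; apply: eq_in_all => X /sL /subsetP sX.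
apply/stabP/stabP => sX' x.
  have [xA|xA] := boolP (x \in A).
    by rewrite (perm_on_fix vB) // inE xA.
  by rewrite -[RHS]sX' permM (perm_on_fix uA).
rewrite permM sX'; have [xA|xA] := boolP (x \in A); last first.
  by rewrite (perm_on_fix uA).
have uxA : u x \in A by rewrite -uA mem_supp uA.
by apply/idP/idP => /sX; rewrite inE ?uxA ?xA.
Qed.

End Derangements.

(** * The number of derangements *)

Section Subfactorial.
Local Open Scope ring_scope.

(** Inclusion-exclusion over the set [U] of points that are forced to be fixed:
    the indicator of [supp s == S] is the product over [x \in S] of
    [1 - (s x == x)], and the expansion is summed over all [s] on [S]. *)
Lemma der_on_formula (T : finType) (S : {set T}) :
  (der_on S)%:Z =
  \sum_(k < #|S|.+1) (-1) ^+ k * (('C(#|S|, k) * (#|S| - k)`!)%N)%:Z.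
Proof.
have expand (s : {perm T}) : perm_on S s ->
    (supp s == S)%:Z = \sum_(U : {set T} | U \subset S)
                        (-1) ^+ #|U| * (perm_on (S :\: U) s)%:Z.
  move=> sS; transitivity
     (\prod_x (- ((x \in S) && (s x == x))%:Z + 1)).
    have [e|ne] := eqVneq (supp s) S.
      rewrite big1 // => x _; rewrite -e suppE.
      by case: (s x == x).
    have [x xS fx] : exists2 x, x \in S & s x == x.
      apply/exists_inP; rewrite -[X in is_true X]negbK negb_exists_in.
      apply: contra ne => /forall_inP ns.
      rewrite eqEsubset -perm_on_supp sS /=; apply/subsetP=> x /ns.
      by rewrite suppE.
    by rewrite (bigD1 x) //= xS fx mul0r.
  rewrite bigA_distr (bigID (fun U : {set T} => U \subset S)) /=.
  rewrite [X in _ + X]big1 ?addr0 => [|U /subsetPn[x xU xS]]; last first.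
    by rewrite (bigD1 x) //= xU (negPf xS) mul0r.
  apply: eq_bigr => U sUS; rewrite (bigID (mem U)) /=.
  rewrite [X in _ * X]big1 ?mulr1 => [|x /negPf ->] //.
  have [/subsetP on|/subsetPn[x xs xSU]] := boolP (perm_on (S :\: U) s).
    rewrite mulr1 -prodr_const; apply: eq_bigr => x xU.
    rewrite xU (subsetP sUS) //=; case: eqP => // /eqP nx.
    by have := on x nx; rewrite inE xU.
  have xS : x \in S by apply: (subsetP sS).
  have xU : x \in U by apply: contraR xSU => xU; rewrite inE xU.
  rewrite !inE in xs.
  by rewrite mulr0 (bigD1 x) //= xU xS (negPf xs) oppr0 mul0r.
have -> : (der_on S)%:Z = \sum_(s : {perm T} | perm_on S s) (supp s == S)%:Z.
  rewrite /der_on -sum1_card (big_morph Posz PoszD (erefl _)) big_mkcond.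
  rewrite [RHS]big_mkcond; apply: eq_bigr => s _; rewrite inE perm_on_supp.
  by case: eqP => [->|_]; rewrite ?subxx ?if_same.
rewrite (eq_bigr _ expand) exchange_big /=.
have cnt (U : {set T}) : U \subset S ->
    \sum_(s : {perm T} | perm_on S s) (-1) ^+ #|U| * (perm_on (S :\: U) s)%:Z
    = (-1) ^+ #|U| * ((#|S| - #|U|)`!)%:Z.
  move=> sU; rewrite -mulr_sumr; congr (_ * _).
  rewrite -(cardsDS sU) -card_perm -sum1_card (big_morph Posz PoszD (erefl _)).
  rewrite big_mkcond [RHS]big_mkcond; apply: eq_bigr => s _.
  rewrite -[s \in _]/(perm_on (S :\: U) s); have [on|_] := boolP (perm_on (S :\: U) s).
    suff -> : perm_on S s by [].
    by move: on; rewrite !perm_on_supp => /subset_trans-> //; apply: subsetDl.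
  by rewrite if_same.
rewrite (eq_bigr _ cnt).
rewrite (partition_big (fun U : {set T} => inord #|U| : 'I_#|S|.+1) xpredT) //=.
apply: eq_bigr => k _; rewrite -cards_draws mulrC PoszM.
rewrite -[#|finset _|]sum1_card (big_morph Posz PoszD (erefl _)) -mulrA mulr_suml.
apply: eq_big => [U|U /andP[sU /eqP <-]].
  rewrite inE; case sU: (_ \subset _) => //=.
  by rewrite -val_eqE /= inordK // ltnS subset_leq_card.
by rewrite inordK ?ltnS ?subset_leq_card // mul1r mulrC.
Qed.

Definition subfact (m : nat) : nat := der_on [set: 'I_m].

Lemma subfact_formula m : (subfact m)%:Z =
  \sum_(k < m.+1) (-1) ^+ k * (('C(m, k) * (m - k)`!)%N)%:Z.
Proof. by rewrite /subfact der_on_formula cardsT card_ord. Qed.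

(** Both sides satisfy the same formula, which only sees the size of [S]; this
    avoids transporting permutations between types. *)
Lemma der_onE (T : finType) (S : {set T}) : der_on S = subfact #|S|.
Proof. by apply/eqP; rewrite -eqz_nat subfact_formula der_on_formula. Qed.

Lemma subfact2 : subfact 2 = 1%N.
Proof.
by apply/eqP; rewrite -eqz_nat subfact_formula !big_ord_recl big_ord0.
Qed.

Lemma subfact3 : subfact 3 = 2%N.
Proof.
by apply/eqP; rewrite -eqz_nat subfact_formula !big_ord_recl big_ord0.
Qed.

Lemma subfact_le m : (subfact m <= m`!)%N.
Proof. by rewrite -{2}(card_ord m) -cardsT der_on_le. Qed.

End Subfactorial.

(** * Bonferroni inequalities *)

Section Bonferroni.

(** Sums over increasing pairs and triples are the binomial moments of the
    number of events that hold. *)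
Lemma sum_pairs (b : nat -> bool) m :
  \sum_(j < m) \sum_(i < j) (b i && b j) = 'C(\sum_(i < m) b i, 2).
Proof.
elim: m => [|m IH]; first by rewrite !big_ord0.
rewrite !big_ord_recr /= IH; case: (b m); last first.
  by rewrite addn0 [X in _ + X]big1 ?addn0 // => i _; rewrite andbF.
rewrite addn1 binS bin1; congr (_ + _).
by apply: eq_bigr => i _; rewrite andbT.
Qed.

Lemma sum_triples (b : nat -> bool) m :
  \sum_(j < m) \sum_(i < j) \sum_(h < i) [&& b h, b i & b j] =
  'C(\sum_(i < m) b i, 3).
Proof.
elim: m => [|m IH]; first by rewrite !big_ord0.
rewrite !big_ord_recr /= IH; case: (b m); last first.
  rewrite addn0 [X in _ + X]big1 ?addn0 // => i _.
  by rewrite big1 // => h _; rewrite !andbF.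
rewrite addn1 binS -sum_pairs; congr (_ + _).
by apply: eq_bigr => i _; apply: eq_bigr => h _; rewrite andbT.
Qed.

Lemma bonferroni_upper g : (0 < g) + 'C(g, 2) <= g + 'C(g, 3).
Proof.
elim: g => // g IH; rewrite (binS g 1) (binS g 2) bin1.
by case: g IH => [|[|g]] // IH; have := leq0n 'C(g.+2, 2); lia.
Qed.

Lemma bonferroni_lower g : g <= (0 < g) + 'C(g, 2).
Proof.
elim: g => // g IH; rewrite (binS g 1) bin1.
by case: g IH => [|g] // IH; lia.
Qed.

(** With two families of events, [g] of the first and [h] of the second kind,
    the second one being rare: the correction [g * h] absorbs every overlap of
    the two kinds, and a linear count suffices for the second. *)
Lemma bonferroni2_lower g h (t : bool) : (0 < g -> t) -> (0 < h -> t) ->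
  g + h <= t + 'C(g, 2) + g * h + 'C(h, 2).
Proof.
have := bonferroni_lower g; have := bonferroni_lower h.
case: h => [|h]; case: g => [|g] /=; rewrite ?bin0n ?muln0 ?mul0n.
- by lia.
- by move=> _ ? /(_ isT) ->; lia.
- by move=> ? _ _ /(_ isT) ->; lia.
by move=> H1 H2 /(_ isT) -> _; have := leq_pmulr g.+1 (ltn0Sn h); lia.
Qed.

End Bonferroni.

(** * Derangements stabilising several sets *)

Section Counting.
Variable T : finType.
Implicit Types (s : {perm T}) (A B X : {set T}) (L : seq {set T}).

Lemma sum_stabs B L :
  \sum_(s : {perm T} | supp s == B) all (stab s) L = stabs B L.
Proof.
rewrite /stabs -sum1_card big_mkcond [RHS]big_mkcond /=.
by apply: eq_bigr => s _; rewrite inE; case: (_ == _); case: (all _ _).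
Qed.

Lemma stabs_disjoint B L : pairwise (fun X Y => [disjoint X & Y]) L ->
    all (fun X => X \subset B) L ->
  stabs B L = (\prod_(X <- L) subfact #|X|)
              * subfact (#|B| - \sum_(X <- L) #|X|).
Proof.
elim: L B => [|A L IH] B; first by rewrite !big_nil stabs_nil der_onE mul1n subn0.
move=> /= /andP[dA dL] /andP[sA sL].
have sLA : all (fun X => X \subset B :\: A) L.
  apply/allP=> X XL; rewrite subsetD (allP sL) //= disjoint_sym.
  exact: (allP dA).
by rewrite stabs_cons // IH // !big_cons der_onE mulnA cardsDS // subnDA.
Qed.

(** No disjointness is assumed: distinct small sets that meet cannot be
    stabilised together by a derangement, and the count is then 0. *)
Lemma stabs_small_le L : uniq L -> all (fun X => #|X| <= 3) L ->
  stabs setT L <= (\prod_(X <- L) (#|X|)`!) * (#|T| - \sum_(X <- L) #|X|)`!.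
Proof.
move=> uL sL.
have [->//|] := posnP (stabs setT L).
rewrite card_gt0 => /set0Pn[s]; rewrite inE => /andP[/eqP sT /allP stL].
rewrite stabs_disjoint.
- by rewrite cardsT leq_mul ?subfact_le // leq_prod // => X _; exact: subfact_le.
- elim: L uL sL stL => //= A L IH /andP[AL uL] /andP[A3 sL] stL.
  rewrite IH ?andbT // => [|X XL]; last by apply: stL; rewrite inE XL orbT.
  apply/allP=> X XL; apply: (stab_small_disjoint sT) => //.
  + by apply: stL; rewrite mem_head.
  + by apply: stL; rewrite inE XL orbT.
  + exact: (allP sL).
  + by apply: contraNneq AL => ->.
by apply/allP=> X _; exact: subsetT.
Qed.

End Counting.

(** * Intervals and cyclic pairs *)

Section Intervals.
Variable n : nat.
Implicit Types (s : 'S_n) (i k : nat).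

Definition interv i k : {set 'I_n} := [set x : 'I_n | i <= x < i + k].

(** The pairs are cyclic, the last one being the two end points. Its complement
    is the middle interval of size [n - 2], so the [n] cyclic pairs account at
    once for all intervals of size 2 and of size [n - 2]. *)
Definition cpair i : {set 'I_n} :=
  [set x : 'I_n | [|| x == i :> nat, x == i.+1 :> nat
                    | (i.+1 == n) && (x == 0 :> nat)]].

Lemma card_interv i k : i + k <= n -> #|interv i k| = k.
Proof.
elim: k => [|k IH] ikn.
  by apply/eqP; rewrite cards_eq0; apply/eqP/setP=> x; rewrite !inE; lia.
have lt : i + k < n by lia.
have -> : interv i k.+1 = Ordinal lt |: interv i k.
  by apply/setP=> x; rewrite !inE -val_eqE /=; lia.
by rewrite cardsU1 !inE /= IH ?ltnn ?andbF //; lia.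
Qed.

Lemma cpair_interv i : i.+1 < n -> cpair i = interv i 2.
Proof. by move=> lt; apply/setP=> x; rewrite !inE; lia. Qed.

Lemma cpair_last : 2 < n -> cpair n.-1 = ~: interv 1 (n - 2).
Proof. by move=> n2; apply/setP=> x; rewrite !inE; have := ltn_ord x; lia. Qed.

Lemma card_cpair i : 2 < n -> i < n -> #|cpair i| = 2.
Proof.
move=> n2 i_n; have [lt|ge] := ltnP i.+1 n.
  by rewrite cpair_interv // card_interv //; lia.
have -> : i = n.-1 by lia.
by rewrite cpair_last // cardsCs setCK card_interv ?card_ord; lia.
Qed.

Lemma cpair_inj i j : 2 < n -> i < n -> j < n -> cpair i = cpair j -> i = j.
Proof.
move=> n2 i_n j_n /setP e.
by have := e (Ordinal i_n); have := e (Ordinal j_n); rewrite !inE /=; lia.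
Qed.

Lemma disjoint_cpair i j : 2 < n -> i < j < n ->
  [disjoint cpair i & cpair j] =
  (i.+1 != j) && ~~ ((j.+1 == n) && (i == 0)).
Proof.
move=> n2 ijn; apply/idP/idP => [|h].
  have i_n : i < n by lia.
  have j_n : j < n by lia.
  move=> d; have := disjointFr d (x := Ordinal j_n).
  have := disjointFl d (x := Ordinal i_n).
  by rewrite !inE /= !eqxx /=; lia.
rewrite disjoint_subset; apply/subsetP => x; rewrite !inE.
by have := ltn_ord x; lia.
Qed.

Lemma nonSIFP s : reflect
  (exists i k, [/\ 0 < k, k < n, i + k <= n & stab s (interv i k)]) (~~ SIF s).
Proof.
apply: (iffP idP).
  rewrite /SIF negb_forall => /existsP[I]; rewrite negb_imply negbK.
  move=> /andP[/and3P[/existsP[i /existsP[j /eqP eI]] I0 IT] sI].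
  have {}eI : I = interv i (j.+1 - i).
    by rewrite eI; apply/setP=> x; rewrite !inE; lia.
  have [ij|ij] := leqP i j; last first.
    case/set0Pn: I0 => x; rewrite eI !inE; lia.
  have jn := ltn_ord j.
  exists i, (j.+1 - i); split; rewrite -?eI //; [lia| |lia].
  move: (proper_card IT); rewrite eI card_interv ?cardsT ?card_ord //; lia.
case=> i [k [k0 kn ikn st]]; rewrite /SIF negb_forall; apply/existsP.
exists (interv i k); rewrite negb_imply negbK [s @: _ == _]st andbT.
have i_n : i < n by lia.
have j_n : i + k.-1 < n by lia.
apply/and3P; split.
- apply/existsP; exists (Ordinal i_n); apply/existsP; exists (Ordinal j_n).
  by apply/eqP/setP => x; rewrite !inE /=; lia.
- by rewrite -card_gt0 card_interv.
by rewrite properEcard subsetT cardsT card_ord card_interv.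
Qed.

Lemma SIF_supp s : 1 < n -> SIF s -> supp s = setT.
Proof.
move=> n1; apply: contraTeq; rewrite -subTset => /subsetPn[x _].
rewrite suppE negbK -stab1 => st.
apply/nonSIFP; exists x, 1; split => //; first by rewrite addn1.
congr (stab s _): st; apply/setP=> y; rewrite !inE -val_eqE /=; lia.
Qed.

End Intervals.

(** * The sieve *)

Section Sieve.
Variable n : nat.
Hypothesis n_ge8 : 8 <= n.
Implicit Types (s : 'S_n).

(** The stabilised intervals are sorted by their contribution: the cyclic pairs
    matter to second order, the triples to first order, and the intervals whose
    size lies between 4 and [n - 3] only contribute to the error term. *)
Definition npairs s := \sum_(i < n) stab s (cpair n i).
Definition ntriples s := \sum_(i < n - 2) stab s (interv n i 3).
Definition nlong s :=
  \sum_(4 <= k < n - 2) \sum_(i < (n - k).+1) stab s (interv n i k).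

Lemma npairs_gt0 s i : i < n -> stab s (cpair n i) -> 0 < npairs s.
Proof.
by move=> i_n st; rewrite /npairs (bigD1 (Ordinal i_n)) //= st.
Qed.

(** An interval of size 1 or [n - 1] would yield a fixed point, and one of size
    [n - 2] has a cyclic pair as complement. *)
Lemma nonSIF_cases s : supp s = setT -> ~~ SIF s ->
  [|| 0 < npairs s, 0 < ntriples s | 0 < nlong s].
Proof.
move=> sT /nonSIFP[i [k [k0 kn ikn st]]].
have k1 : k != 1 by have := card_stab_neq1 sT st; rewrite card_interv.
have kn1 : k != n.-1.
  have := card_stab_neq1 sT (stabC st).
  by rewrite cardsCs setCK card_interv // card_ord; lia.
have [k2|k2] := eqVneq k 2.
  by rewrite (@npairs_gt0 s i) ?cpair_interv -?k2 //; lia.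
have [k3|k3] := eqVneq k 3.
  have i_lt : i < n - 2 by lia.
  by rewrite /ntriples (bigD1 (Ordinal i_lt)) //= -k3 st orbT.
have [kn2|kn2] := eqVneq k (n - 2).
  have : [|| i == 0, i == 1 | i == 2] by lia.
  move: (stabC st) => stC; case/or3P=> /eqP i_eq.
  - rewrite (@npairs_gt0 s (n - 2)) //; first lia.
    congr (stab s _): stC; rewrite cpair_interv; last lia.
    by apply/setP=> x; rewrite !inE; have := ltn_ord x; lia.
  - rewrite (@npairs_gt0 s n.-1) //; first lia.
    by rewrite cpair_last -?kn2 -?i_eq //; lia.
  rewrite (@npairs_gt0 s 0) //; first lia.
  congr (stab s _): stC; rewrite cpair_interv; last lia.
  by apply/setP=> x; rewrite !inE; have := ltn_ord x; lia.
suff -> : 0 < nlong s by rewrite !orbT.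
have i_lt : i < (n - k).+1 by lia.
rewrite /nlong (bigD1_seq k) ?mem_index_iota ?iota_uniq //=; last by lia.
by rewrite (bigD1 (Ordinal i_lt)) //= st.
Qed.

Lemma pairs_nonSIF s : 0 < npairs s -> ~~ SIF s.
Proof.
rewrite lt0n sum_nat_eq0 negb_forall => /existsP[i]; rewrite /= eqb0 negbK => st.
have i_n := ltn_ord i; apply/nonSIFP; have [lt|ge] := ltnP i.+1 n.
  by exists i, 2; split; rewrite -?cpair_interv //; lia.
exists 1, (n - 2); split; [lia|lia|lia|].
have i_eq : i = n.-1 :> nat by lia.
by move/stabC: st; rewrite i_eq cpair_last ?setCK //; lia.
Qed.

Lemma triples_nonSIF s : 0 < ntriples s -> ~~ SIF s.
Proof.
rewrite lt0n sum_nat_eq0 negb_forall => /existsP[i]; rewrite /= eqb0 negbK => st.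
have i_n := ltn_ord i; apply/nonSIFP.
by exists i, 3; split => //; lia.
Qed.

Lemma sieve_upper s : supp s = setT ->
  ~~ SIF s + 'C(npairs s, 2) <= npairs s + ntriples s + nlong s + 'C(npairs s, 3).
Proof.
move=> sT; have := bonferroni_upper (npairs s).
case: (boolP (SIF s)) => [_|/(nonSIF_cases sT)] /=; lia.
Qed.

Lemma sieve_lower s : npairs s + ntriples s <=
  ~~ SIF s + 'C(npairs s, 2) + npairs s * ntriples s + 'C(ntriples s, 2).
Proof. exact: bonferroni2_lower (@pairs_nonSIF s) (@triples_nonSIF s). Qed.

End Sieve.

(** * Estimates for factorials and sums *)

(** Log-convexity of the factorial: among products with a given sum of sizes,
    the most unbalanced one is the largest. *)
Lemma factM_le a k l : a <= k -> a <= l -> k`! * l`! <= a`! * (k + l - a)`!.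
Proof.
move=> ak al; rewrite -(subnKC ak); elim: (k - a) => [|d IH].
  by rewrite addn0 addKn.
rewrite addnS factS.
have -> : (a + d).+1 + l - a = (a + d + l - a).+1 by lia.
rewrite factS -mulnA [leqRHS]mulnCA leq_mul //; lia.
Qed.

(** Unordered pairs of non-adjacent points on a cycle with [n] points, counted
    twice: the diagonals of an [n]-gon. *)
Lemma nonadjacent_pairs n : 3 <= n ->
  (\sum_(j < n) \sum_(i < j) ((i.+1 != j) && ~~ ((j.+1 == n) && (i == 0 :> nat))))
  * 2 = n * (n - 3).
Proof.
case: n => // n n2; rewrite big_ord_recr /=.
have -> : \sum_(i < n) ((i.+1 != n) && ~~ ((n.+1 == n.+1) && (i == 0 :> nat)))
          = n - 2.
  case: n n2 => // -[|n] // _; rewrite big_ord_recl big_ord_recr /= !eqxx /=.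
  rewrite addn0 add0n subn2 /= -[RHS]card_ord -sum1_card.
  by apply: eq_bigr => i _; rewrite /bump /= !eqSS; have := ltn_ord i; lia.
have -> : \sum_(j < n) \sum_(i < j)
            ((i.+1 != j) && ~~ ((j.+1 == n.+1) && (i == 0 :> nat)))
          = \sum_(j < n) j.-1.
  apply: eq_bigr => -[[|j] jn] _ /=; first by rewrite big_ord0.
  rewrite big_ord_recr /= eqxx addn0 -[RHS]card_ord -sum1_card.
  by apply: eq_bigr => i _; have := ltn_ord i; lia.
have sum_pred m : (\sum_(j < m.+1) j.-1) * 2 = m * m.-1.
  elim: m => [|m IH]; first by rewrite big_ord1.
  by rewrite big_ord_recr /= mulnDl IH; case: m {IH} => //= m; lia.
case: n n2 => // n n2; rewrite mulnDl sum_pred.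
by case: n n2 => //= n _; rewrite !subSS subn0; lia.
Qed.

Lemma fact_subn n k : k < n -> (n - k)`! = (n - k) * (n - k.+1)`!.
Proof. by move=> kn; rewrite -subnSK // factS. Qed.

Lemma sum_ord_le m N d (F : 'I_m -> nat) :
  m <= N -> (forall i, F i <= d) -> \sum_(i < m) F i <= N * d.
Proof.
move=> mN Fd; apply: (@leq_trans (\sum_(i < m) d)); first exact: leq_sum.
by rewrite sum_nat_const card_ord leq_mul2r mN orbT.
Qed.

(** * Moments of the numbers of stabilised sets *)

Section Moments.
Variable n : nat.
Hypothesis n_ge8 : 8 <= n.

Let n_gt2 : 2 < n.
Proof. exact: leq_trans n_ge8. Qed.

Lemma sum_npairs : \sum_(s : 'S_n | supp s == setT) npairs s = n * subfact (n - 2).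
Proof.
rewrite exchange_big /= -[X in X * _]card_ord -sum_nat_const.
apply: eq_bigr => i _; under eq_bigr do rewrite -[stab _ _]andbT.
rewrite (sum_stabs _ [:: cpair n i]) stabs_disjoint //=; last by rewrite subsetT.
by rewrite !big_seq1 cardsT card_ord card_cpair ?subfact2 ?mul1n //; lia.
Qed.

Lemma sum_ntriples :
  \sum_(s : 'S_n | supp s == setT) ntriples s =
  (n - 2) * (2 * subfact (n - 3)).
Proof.
rewrite exchange_big /= -[X in X * _]card_ord -sum_nat_const.
apply: eq_bigr => i _; under eq_bigr do rewrite -[stab _ _]andbT.
rewrite (sum_stabs _ [:: interv n i 3]) stabs_disjoint //=; last by rewrite subsetT.
rewrite !big_seq1 cardsT card_ord card_interv ?subfact3 //.
by have := ltn_ord i; lia.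
Qed.

(** Cyclic pairs that meet are never stabilised together, so only the diagonals
    of an [n]-gon contribute. *)
Lemma sum_pairs_npairs :
  (\sum_(s : 'S_n | supp s == setT) 'C(npairs s, 2)) * 2 =
  n * (n - 3) * subfact (n - 4).
Proof.
rewrite -(nonadjacent_pairs (n := n)); last lia.
rewrite mulnAC; congr (_ * _).
under eq_bigr do rewrite -(sum_pairs (fun i => stab _ (cpair n i))).
rewrite exchange_big /= big_distrl; apply: eq_bigr => j _ /=.
rewrite exchange_big /= big_distrl; apply: eq_bigr => i _ /=.
have ij := ltn_ord i; have jn := ltn_ord j; have i_n := ltn_trans ij jn.
under eq_bigr do rewrite -[stab _ (cpair n j)]andbT.
rewrite (sum_stabs _ [:: cpair n i; cpair n j]).
rewrite -(@disjoint_cpair n); [|lia|by rewrite ij].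
have [d|nd] := boolP [disjoint _ & _].
  rewrite stabs_disjoint //=; [|by rewrite d|by rewrite !subsetT].
  rewrite !big_cons !big_nil !card_cpair ?subfact2 //; try lia.
  by rewrite cardsT card_ord.
rewrite mul0n; apply/eqP; rewrite cards_eq0; apply/eqP/setP=> s.
rewrite !inE; apply/negP=> /= /and4P[/eqP sT si sj _]; case/negP: nd.
apply: (stab_small_disjoint sT) => //; rewrite ?card_cpair //; try lia.
by apply/eqP => /(cpair_inj n_gt2 i_n jn); lia.
Qed.

(** There are at most [n^3] triples of pairs, each stabilised by at most
    [2!^3 (n - 6)!] derangements, and [n^3 <= 9 (n - 3) (n - 4) (n - 5)]. *)
Lemma sum_triples_npairs :
  \sum_(s : 'S_n | supp s == setT) 'C(npairs s, 3) <= 72 * (n - 3)`!.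
Proof.
under eq_bigr do rewrite -(sum_triples (fun i => stab _ (cpair n i))).
pose c := 8 * (n - 6)`!.
have bound h i j : h < i -> i < j -> j < n ->
    \sum_(s : 'S_n | supp s == setT)
      [&& stab s (cpair n h), stab s (cpair n i) & stab s (cpair n j)] <= c.
  move=> hi ij jn; have i_n := ltn_trans ij jn; have h_n := ltn_trans hi i_n.
  under eq_bigr do rewrite -[stab _ (cpair n j)]andbT.
  rewrite (sum_stabs _ [:: cpair n h; cpair n i; cpair n j]).
  apply: leq_trans (stabs_small_le _ _) _; rewrite /= ?inE ?card_cpair //.
    rewrite andbT negb_or -andbA; apply/and3P; split; apply/eqP.
    - by move/(cpair_inj n_gt2 h_n i_n); lia.
    - by move/(cpair_inj n_gt2 h_n jn); lia.
    by move/(cpair_inj n_gt2 i_n jn); lia.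
  by rewrite !big_cons !big_nil !card_cpair // card_ord.
apply: (@leq_trans (n * (n * (n * c)))).
  rewrite exchange_big /=; apply: sum_ord_le => // j.
  rewrite exchange_big /=; apply: sum_ord_le => [|i]; first exact: ltnW.
  rewrite exchange_big /=; apply: sum_ord_le => [|h].
    by apply: ltnW; apply: ltn_trans (ltn_ord i) (ltn_ord j).
  exact: bound.
rewrite /c (@fact_subn n 3) ?(@fact_subn n 4) ?(@fact_subn n 5); do ?lia.
set F := (n - 6)`!.
have : n * n * n <= 9 * ((n - 3) * (n - 4) * (n - 5)).
  rewrite -(subnK n_ge8); move: (n - 8) => m.
  have -> : m + 8 - 3 = m + 5 by lia.
  have -> : m + 8 - 4 = m + 4 by lia.
  have -> : m + 8 - 5 = m + 3 by lia.
  by nia.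
move=> /(leq_mul (leqnn (8 * F))).
move: (n - 3) (n - 4) (n - 5) => a b d; lia.
Qed.

Lemma sum_npairs_ntriples :
  \sum_(s : 'S_n | supp s == setT) npairs s * ntriples s <= 36 * (n - 3)`!.
Proof.
under eq_bigr do rewrite /npairs big_distrlr /=.
(* 12 is 2! 3!, from a pair and a triple *)
pose c := 12 * (n - 5)`!.
apply: (@leq_trans (n * ((n - 2) * c))).
  rewrite exchange_big /=; apply: sum_ord_le => // i.
  rewrite exchange_big /=; apply: sum_ord_le => // j.
  have jn := ltn_ord j; have j_n : j + 3 <= n by lia.
  under eq_bigr do rewrite mulnb -[stab _ (interv n j 3)]andbT.
  rewrite (sum_stabs _ [:: cpair n i; interv n j 3]).
  apply: leq_trans (stabs_small_le _ _) _;
    rewrite /= ?inE ?card_cpair ?card_interv //.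
    rewrite andbT; apply/eqP => e; have := card_cpair n_gt2 (ltn_ord i).
    by rewrite e card_interv.
  by rewrite !big_cons !big_nil card_cpair // card_interv // card_ord.
rewrite /c (@fact_subn n 3) ?(@fact_subn n 4); do ?lia.
set F := (n - 5)`!.
have : n * (n - 2) <= 3 * ((n - 3) * (n - 4)).
  rewrite -(subnK n_ge8); move: (n - 8) => m.
  have -> : m + 8 - 2 = m + 6 by lia.
  have -> : m + 8 - 3 = m + 5 by lia.
  have -> : m + 8 - 4 = m + 4 by lia.
  by nia.
move=> /(leq_mul (leqnn (12 * F))).
move: (n - 2) (n - 3) (n - 4) => a b d; lia.
Qed.

Lemma sum_pairs_ntriples :
  \sum_(s : 'S_n | supp s == setT) 'C(ntriples s, 2) <= 36 * (n - 3)`!.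
Proof.
under eq_bigr do rewrite -(sum_pairs (fun i => stab _ (interv n i 3))).
(* 36 is 3!^2, from two triples *)
pose c := 36 * (n - 6)`!.
apply: (@leq_trans ((n - 2) * ((n - 2) * c))).
  rewrite exchange_big /=; apply: sum_ord_le => // j.
  rewrite exchange_big /=; apply: sum_ord_le => [|i]; first exact: ltnW.
  have jn := ltn_ord j; have j_n : j + 3 <= n by lia.
  have ij := ltn_ord i; have i_n : i + 3 <= n by lia.
  under eq_bigr do rewrite -[stab _ (interv n j 3)]andbT.
  rewrite (sum_stabs _ [:: interv n i 3; interv n j 3]).
  apply: leq_trans (stabs_small_le _ _) _; rewrite /= ?inE ?card_interv //.
    rewrite andbT; apply/eqP => /setP e.
    have i_lt : i < n by lia.
    by have := e (Ordinal i_lt); rewrite !inE /=; lia.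
  by rewrite !big_cons !big_nil !card_interv // card_ord.
rewrite /c (@fact_subn n 3) ?(@fact_subn n 4) ?(@fact_subn n 5); do ?lia.
set F := (n - 6)`!.
have : (n - 2) * (n - 2) <= (n - 3) * (n - 4) * (n - 5).
  rewrite -(subnK n_ge8); move: (n - 8) => m.
  have -> : m + 8 - 2 = m + 6 by lia.
  have -> : m + 8 - 3 = m + 5 by lia.
  have -> : m + 8 - 4 = m + 4 by lia.
  have -> : m + 8 - 5 = m + 3 by lia.
  by nia.
move=> /(leq_mul (leqnn (36 * F))).
move: (n - 2) (n - 3) (n - 4) (n - 5) => a b d e; lia.
Qed.

(** The intervals of size [k] contribute at most [k! (n + 1 - k)!], of order
    [(n - 3)!] for the two extreme sizes 4 and [n - 3], distinct as [n >= 8], and of order [(n - 4)!]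
    for each of the at most [n] sizes in between. *)
Lemma sum_nlong : \sum_(s : 'S_n | supp s == setT) nlong s <= 168 * (n - 3)`!.
Proof.
rewrite exchange_big /=.
have bound k : 4 <= k < n - 2 ->
    \sum_(s : 'S_n | supp s == setT) \sum_(i < (n - k).+1) stab s (interv n i k)
    <= k`! * (n.+1 - k)`!.
  move=> kn; have -> : n.+1 - k = (n - k).+1 by lia.
  rewrite factS mulnCA exchange_big /=; apply: sum_ord_le => // i.
  have i_lt := ltn_ord i; have ikn : i + k <= n by lia.
  under eq_bigr do rewrite -[stab _ _]andbT.
  rewrite (sum_stabs _ [:: interv n i k]) stabs_disjoint //=; last by rewrite subsetT.
  by rewrite !big_seq1 cardsT card_ord card_interv // leq_mul // subfact_le.
have end_bound k : 4 <= k < n - 2 -> k`! * (n.+1 - k)`! <= 24 * (n - 3)`!.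
  move=> kn; have -> : n - 3 = k + (n.+1 - k) - 4 by lia.
  by apply: (@factM_le 4); lia.
have mid_bound k : 5 <= k < n - 3 -> k`! * (n.+1 - k)`! <= 120 * (n - 4)`!.
  move=> kn; have -> : n - 4 = k + (n.+1 - k) - 5 by lia.
  by apply: (@factM_le 5); lia.
rewrite big_nat; apply: leq_trans (leq_sum _ bound) _; rewrite -big_nat.
rewrite big_ltn; last lia.
have -> : n - 2 = (n - 3).+1 by lia.
rewrite big_nat_recr /=; last lia.
have /end_bound e_first : 4 <= 4 < n - 2 by lia.
have /end_bound e_last : 4 <= n - 3 < n - 2 by lia.
have : \sum_(5 <= k < n - 3) k`! * (n.+1 - k)`! <= (n - 8) * (120 * (n - 4)`!).
  rewrite big_nat; apply: leq_trans (leq_sum _ mid_bound) _.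
  by rewrite -big_nat sum_nat_const_nat; have -> : n - 3 - 5 = n - 8 by lia.
have : (n - 8) * (120 * (n - 4)`!) <= 120 * (n - 3)`!.
  have -> : n - 3 = (n - 4).+1 by lia.
  by rewrite factS mulnCA leq_mul2l leq_mul2r; apply/orP; right; lia.
by move: e_first e_last; lia.
Qed.

Lemma num_SIF_complement :
  num_SIF n + \sum_(s : 'S_n | supp s == setT) ~~ SIF s = subfact n.
Proof.
rewrite -[in RHS](card_ord n) -cardsT -der_onE /der_on -sum1_card.
rewrite [RHS](eq_bigl (fun s : 'S_n => supp s == setT)) => [|s]; last by rewrite inE.
rewrite /num_SIF -sum1_card big_mkcond [X in _ + X]big_mkcond [RHS]big_mkcond.
rewrite -big_split /=; apply: eq_bigr => s _; rewrite inE.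
case: ifPn => [/(SIF_supp (ltnW n_gt2)) ->|_]; last by case: ifP.
by rewrite eqxx.
Qed.

(** The sieve summed over all derangements; everything is doubled to avoid
    halving [n (n - 3)], and 480 is twice 168 + 72, the bounds for the long
    intervals and for the triples of pairs. *)
Lemma num_SIF_sieve :
  let main := 2 * (n * subfact (n - 2)) + 4 * ((n - 2) * subfact (n - 3)) in
  let pairs := n * (n - 3) * subfact (n - 4) in
  2 * num_SIF n + main <= 2 * subfact n + pairs + 480 * (n - 3)`! /\
  2 * subfact n + pairs <= 2 * num_SIF n + main + 480 * (n - 3)`!.
Proof.
have hU : \sum_(s : 'S_n | supp s == setT) (~~ SIF s + 'C(npairs s, 2)) <=
  \sum_(s : 'S_n | supp s == setT) (npairs s + ntriples s + nlong s + 'C(npairs s, 3)).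
  by apply: leq_sum => s /eqP; apply: sieve_upper.
have hL : \sum_(s : 'S_n | supp s == setT) (npairs s + ntriples s) <=
  \sum_(s : 'S_n | supp s == setT) (~~ SIF s + 'C(npairs s, 2) + npairs s * ntriples s
                     + 'C(ntriples s, 2)).
  by apply: leq_sum => s _; apply: sieve_lower.
move: hU hL; rewrite !big_split /= sum_npairs sum_ntriples.
have := num_SIF_complement; have := sum_pairs_npairs.
have := sum_triples_npairs; have := sum_npairs_ntriples.
have := sum_pairs_ntriples; have := sum_nlong.
set F := (n - 3)`!; set C2 := \sum_(s | _) 'C(npairs s, 2).
set C3 := \sum_(s | _) 'C(npairs s, 3); set H2 := \sum_(s | _) 'C(ntriples s, 2).
set GH := \sum_(s | _) npairs s * _; set L := \sum_(s | _) nlong s.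
set N := \sum_(s | _) ~~ SIF s; move: L H2 GH C3 C2 N F.
lia.
Qed.

End Moments.

(** * Asymptotic expansion *)

Local Open Scope classical_set_scope.
Local Open Scope ring_scope.

Section Asymptotics.
Variable R : realType.

(** Dividing the alternating formula by [m!] leaves the partial sum, with
    [m + 1] terms, of the exponential series at -1. *)
Lemma subfact_exp_series m :
  (subfact m)%:R = (m`!)%:R * series (exp_coeff (-1)) m.+1 :> R.
Proof.
have : ((subfact m)%:Z)%:~R = (subfact m)%:R :> R by [].
rewrite subfact_formula => <-; rewrite rmorph_sum /= /series /= big_mkord mulr_sumr.
apply: eq_bigr => k _; rewrite rmorphM rmorphXn /= rmorphN1 /exp_coeff.
have k_m : (k <= m)%N by rewrite -ltnS.
have k0 : (k`!)%:R != 0 :> R by rewrite pnatr_eq0 -lt0n fact_gt0.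
rewrite -(bin_fact k_m) -pmulrn !natrM.
by rewrite /=; field.
Qed.

(** The right-hand side telescopes, as [2 / N! <= 1 / (N - 1)!] for [N >= 2]; it
    is bounded uniformly in [N], which is what the limit needs. *)
Lemma exp_tail m N : (0 < m)%N -> (m < N)%N ->
  `|series (exp_coeff (-1)) N - series (exp_coeff (-1)) m.+1| <=
    (m`!)%:R^-1 - (N.-1`!)%:R^-1 :> R.
Proof.
move=> m0; elim: N => // N IH; rewrite ltnS leq_eqVlt => /predU1P[->|mN].
  by rewrite !subrr normr0.
have {}IH := IH mN; rewrite seriesS -addrA.
apply: le_trans (ler_normD _ _) _.
have fact_gt (k : nat) : 0 < (k`!)%:R :> R by rewrite ltr0n fact_gt0.
have -> : `|exp_coeff (-1 : R) N| = (N`!)%:R^-1.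
  by rewrite /exp_coeff normrM normrX normrN1 expr1n mul1r ger0_norm // invr_ge0 ltW.
suff : 2 * (N`!)%:R^-1 <= (N.-1`!)%:R^-1 :> R by move: IH => /=; lra.
case: N mN {IH} => // N mN /=.
rewrite factS natrM invfM mulrA -[leRHS]mul1r ler_pM2r ?invr_gt0 //.
by rewrite ler_pdivrMr ?ltr0n // mul1r ler_nat; lia.
Qed.

Lemma subfact_approx m : (0 < m)%N ->
  `|(subfact m)%:R - (m`!)%:R * (expR 1)^-1| <= 1 :> R.
Proof.
move=> m0; have fact_gt (k : nat) : 0 < (k`!)%:R :> R by rewrite ltr0n fact_gt0.
rewrite subfact_exp_series -mulrBr normrM (ger0_norm (ltW (fact_gt m))).
rewrite mulrC -ler_pdivlMr // mul1r -expRN distrC.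
have cvg_exp := is_cvg_series_exp_coeff (-1 : R).
have tail N : (m < N)%N -> `|series (exp_coeff (-1)) N -
    series (exp_coeff (-1)) m.+1| <= (m`!)%:R^-1 :> R.
  move=> mN; apply: le_trans (exp_tail m0 mN) _.
  by rewrite gerBl invr_ge0 ltW.
rewrite ler_norml lerBrDr lerBlDr /expR; apply/andP; split.
- apply: limr_ge => //; exists m.+1 => // N /= mN.
  by have := tail N mN; rewrite ler_norml => /andP[]; lra.
apply: limr_le => //; exists m.+1 => // N /= mN.
by have := tail N mN; rewrite ler_norml => /andP[]; lra.
Qed.

Lemma fact_top3 n : (2 < n)%N ->
  (n`!)%:R = n%:R * (n%:R - 1) * (n%:R - 2) * ((n - 3)`!)%:R :> R.
Proof.
case: n => [|[|[|n]]] // _; rewrite subSS subSS subSS subn0 !factS !natrM !mulrA.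
have x3 : n.+3%:R = n%:R + 3 :> R by rewrite -natrD addn3.
have x2 : n.+2%:R = n%:R + 2 :> R by rewrite -natrD addn2.
have x1 : n.+1%:R = n%:R + 1 :> R by rewrite natr1.
by rewrite x3 x2 x1; ring.
Qed.

(** With [F = (n - 3)!], replacing each subfactorial [d_k] by [k! / e] in the
    sieve turns its main terms into a polynomial multiple of [F / e], which
    agrees with the expansion up to [(10 / n - 3) F / e]; the replacement
    itself costs [O(n^2)], that is [O(F)]. *)
Lemma num_SIF_approx n : (8 <= n)%N ->
  `|(num_SIF n)%:R - (n`!)%:R * (expR 1)^-1 *
      (1 - 1 / n%:R - 5%:R / (2%:R * n%:R ^+ 2))| <= 250%:R * ((n - 3)`!)%:R :> R.
Proof.
move=> n8.
have [up low] := num_SIF_sieve n8.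
set x : R := n%:R; set a : R := (num_SIF n)%:R; set c : R := (expR 1)^-1.
set F : R := ((n - 3)`!)%:R; set G : R := ((n - 4)`!)%:R.
have x8 : 8 <= x by rewrite (ler_nat R 8).
have natB k : (k <= 8)%N -> (n - k)%:R = x - k%:R :> R.
  by move=> k8; rewrite natrB //; apply: leq_trans n8.
have FE : F = (x - 3) * G.
  by rewrite /F /G -(natB 3) // -natrM fact_subn //; lia.
have N2E : ((n - 2)`!)%:R = (x - 2) * F.
  by rewrite /F -(natB 2) // -natrM fact_subn //; lia.
have NE : (n`!)%:R = x * (x - 1) * (x - 2) * F by apply: fact_top3; lia.
have c_gt0 : 0 < c by rewrite invr_gt0 expR_gt0.
have c_le1 : c <= 1.
  by rewrite invf_le1 ?expR_gt0 //; have := expR_ge1Dx (1 : R); lra.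
have sq_le : x ^+ 2 <= 5 * F.
  have H1 : 1 <= ((n - 5)`!)%:R :> R by rewrite ler1n fact_gt0.
  have -> : F = (x - 3) * (x - 4) * ((n - 5)`!)%:R.
    by rewrite FE -mulrA -(natB 4) // -natrM -fact_subn //; lia.
  apply: (@le_trans _ _ (5 * ((x - 3) * (x - 4)))); first nra.
  by rewrite ler_pM2l // ler_peMr //; nra.
pose d k : R := (subfact (n - k))%:R.
pose eps k : R := d k - ((n - k)`!)%:R * c.
have eps_le k : (k <= 4)%N -> -1 <= eps k <= 1.
  by move=> k4; rewrite -ler_norml; apply: subfact_approx; lia.
pose delta := 2 * a + (2 * (x * d 2%N) + 4 * ((x - 2) * d 3%N)) -
  (2 * d 0%N + x * (x - 3) * d 4%N).
have delta_le : -(480 * F) <= delta <= 480 * F.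
  set K := 480%N in up low.
  have cast (p q : nat) : (p <= q)%N -> p%:R <= q%:R :> R by rewrite ler_nat.
  move: (cast _ _ up) (cast _ _ low); rewrite /delta /d subn0.
  rewrite !natrD !natrM (natB 2%N isT) (natB 3%N isT) -/a -/x -/F /K.
  lra.
have /andP[? ?] := eps_le 0%N isT.
(* [eps k] is the error of [(n - k)! / e], [delta] that of the sieve. *)
have key : 2 * (a - (n`!)%:R * c * (1 - 1 / x - 5%:R / (2%:R * x ^+ 2))) =
    F * c * (10 / x - 3) + (2 * eps 0%N - 2 * x * eps 2%N
      - 4 * (x - 2) * eps 3%N + x * (x - 3) * eps 4%N) + delta.
  rewrite /delta /eps subn0 N2E NE -/F -/G FE; field.
  by rewrite gt_eqF //; lra.
have F_ge0 : 0 <= F by rewrite ler0n.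
have inv_x : 0 <= 10 / x <= 2.
  by rewrite divr_ge0 ?ler_pdivrMr //=; lra.
have Fc_le : -(3 * F) <= F * c * (10 / x - 3) <= 0.
  have Fc : 0 <= F * c <= F by rewrite mulr_ge0 ?ler_piMr // ltW.
  move: inv_x Fc; move: (10 / x) (F * c) => y z /andP[y0 y2] /andP[z0 zF].
  by apply/andP; split; nra.
have scaled y k : 0 <= y -> (k <= 4)%N -> -y <= y * eps k <= y.
  by move=> y0 /eps_le/andP[l u]; apply/andP; split; nra.
have poly : 2 + 2 * x + 4 * (x - 2) + x * (x - 3) <= 10 * F by nra.
have /andP[? ?] := scaled (2 * x) 2%N ltac:(lra) isT.
have /andP[? ?] := scaled (4 * (x - 2)) 3%N ltac:(lra) isT.
have /andP[? ?] := scaled (x * (x - 3)) 4%N ltac:(nra) isT.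
have /andP[? ?] := Fc_le; have /andP[? ?] := delta_le.
(* 480 F for the sieve, 10 F for the subfactorials and 3 F for the expansion
   make less than 500 F, twice the claimed bound. *)
by rewrite ler_norml; apply/andP; split; lra.
Qed.

End Asymptotics.

Theorem corollary11 (R : realType) :
  exists2 r : nat -> R,
    r =O_\oo (fun n : nat => (n%:R ^+ 3)^-1 : R) &
    forall n : nat, (0 < n)%N ->
      (num_SIF n)%:R / (n`!)%:R =
      (expR 1)^-1 * (1 - 1 / n%:R - 5%:R / (2%:R * n%:R ^+ 2) + r n) :> R.
Proof.
pose main (n : nat) : R := 1 - 1 / n%:R - 5%:R / (2%:R * n%:R ^+ 2).
exists (fun n => expR 1 * ((num_SIF n)%:R / (n`!)%:R) - main n); last first.
  by move=> n _; rewrite -/(main n) addrC subrK mulKf // gt_eqF ?expR_gt0.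
apply/eqO_exP; exists (500%:R * expR 1); first by rewrite mulr_gt0 ?ltr0n ?expR_gt0.
exists 8%N => // n /= n8; have e_gt0 := expR_gt0 (1 : R).
have x8 : 8 <= n%:R :> R by rewrite (ler_nat R 8).
have N_gt0 : 0 < (n`!)%:R :> R by rewrite ltr0n fact_gt0.
have NE : (n`!)%:R = n%:R * (n%:R - 1) * (n%:R - 2) * ((n - 3)`!)%:R :> R.
  by apply: fact_top3; apply: leq_trans n8.
have := num_SIF_approx R n8; rewrite -/(main n).
set a : R := (num_SIF n)%:R; set N : R := (n`!)%:R in N_gt0 NE *.
set F : R := ((n - 3)`!)%:R in NE *; set x : R := n%:R in x8 NE *.
move=> approx.
have F_gt0 : 0 < F by rewrite ltr0n fact_gt0.
have -> : expR 1 * (a / N) - main n =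
    expR 1 / N * (a - N * (expR 1)^-1 * main n).
  by field; rewrite !gt_eqF.
have eN_ge0 : 0 <= expR 1 / N by rewrite divr_ge0 ?ltW.
have x3 : 0 < x ^+ 3 by rewrite exprn_gt0 //; lra.
have x3V_ge0 : 0 <= (x ^+ 3)^-1 by rewrite invr_ge0 ltW.
rewrite normrM (ger0_norm eN_ge0) (ger0_norm x3V_ge0).
apply: le_trans (ler_wpM2l eN_ge0 approx) _.
have -> : expR 1 / N * (250 * F) = expR 1 * (250 / (x * (x - 1) * (x - 2))).
  by rewrite NE; field; rewrite !gt_eqF //; lra.
have -> : 500 * expR 1 * (x ^+ 3)^-1 = expR 1 * (500 / x ^+ 3) by ring.
apply: ler_wpM2l; first exact: ltW.
have q_gt0 : 0 < x * (x - 1) * (x - 2) by rewrite !mulr_gt0 //; lra.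
rewrite ler_pdivrMr // mulrAC ler_pdivlMr //.
have : x * x <= 2 * ((x - 1) * (x - 2)) by nra.
have x0 : 0 <= x by lra.
move=> /(ler_wpM2l x0); lra.
Qed.
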